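(* Let $P(x)=R(x)-q$ be a real polynomial in $x$ of degree $n\ge 2$, with $R(0)=0$ and $q\in\mathbb{R}$. Set $D(q)=\operatorname{dis}_x(P(x))$ and assume that all the roots of $R$ are simple. Define the polynomials $\mathcal{D}(q)=\operatorname{sgn}(D(0))\,D(q)$ and $\mathcal{U}(x)=\mathcal{D}(R(x))/(R'(x))^2$, and the functions $$\phi(x)=\operatorname{sgn}(R'(0))\int_0^x\frac{G(R(s))}{\sqrt{\mathcal{U}(s)}}\,\mathrm{d}s\qquad\text{and}\qquad \varphi(q)=\int_0^q\frac{G(t)}{\sqrt{\mathcal{D}(t)}}\,\mathrm{d}t,$$ where $G$ is any continuous real function satisfying $G(0)\neq 0$. Then, in a neighborhood of $0$, $\phi$ is invertible and $$x=\phi^{-1}(\varphi(q))$$ is a root of $P(x)=0$ that goes to $0$ as $q$ tends to $0$. In particular, if $G$ is a polynomial, then $\phi$ and $\varphi$ are elliptic or hyperelliptic integrals.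
   Context: $R\in\mathbb{R}[x]$ is a polynomial of degree $n$ not depending on $q$. $\operatorname{dis}_x(P(x))$ denotes the usual discriminant of $P$ as a polynomial of degree $n$ in $x$; it is a polynomial $D(q)$ in $q$. ''All the roots of $R$'' refers to all roots of $R$ in $\mathbb{C}$. It is a fact that $(R'(x))^2$ divides $D(R(x))$ as polynomials in $x$, so that $\mathcal{U}$ is a polynomial. $\operatorname{sgn}$ is the sign function. The functions $\phi$ and $\varphi$ are considered for arguments in a sufficiently small neighborhood of $0$. Elliptic or hyperelliptic integrals are understood in the broad sense of integrals of the form $\int_0^x r\big(s,\sqrt{h(s)}\big)\,\mathrm{d}s$ with $r$ a rational function of two variables and $h$ a polynomial (low-degree degenerate cases, where the integral is elementary, being allowed). *)

(* Defs.v *)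
From HB Require Import structures.
From mathcomp Require Import all_boot all_order all_algebra.
From mathcomp Require Import all_classical all_reals all_analysis.
From mathcomp Require Import complex.

Set Implicit Arguments.
Unset Strict Implicit.
Unset Printing Implicit Defensive.

Import Order.TTheory GRing.Theory Num.Theory.
Import numFieldNormedType.Exports.

Local Open Scope classical_set_scope.
Local Open Scope ring_scope.

(* (-1)^(n(n-1)/2) Res(p, p') / lead_coef p, with n = deg p. The leading
   coefficient must be a unit, and p' must have degree n - 1: over {poly K}
   with K of characteristic 0, this holds when lead_coef p is a nonzero
   constant. The Sylvester matrix lists coefficients in ascending order, which
   changes the determinant by the factor (-1)^(n(n-1)) = 1. *)
Definition discriminant (A : comUnitRingType) (p : {poly A}) : A :=
  (-1) ^+ 'C((size p).-1, 2) * resultant p p^`() / lead_coef p.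

Section Inversion.
Variables (K : realType) (R : {poly K}).

Definition shifted (q : K) : {poly K} := R - q%:P.

(* D(q) as a polynomial in q: the discriminant of R(x) - q in the outer
   variable x, the inner variable of {poly {poly K}} being q. *)
Definition discr_shifted : {poly K} :=
  discriminant (map_poly polyC R - ('X : {poly K})%:P).

Definition calD : {poly K} := Num.sg discr_shifted.[0] *: discr_shifted.

(* The division is exact, since R'(x)^2 divides D(R(x)). *)
Definition calU : {poly K} := (calD \Po R) %/ (R^`() ^+ 2).

(* The roots are the complex ones; mup is the
   multiplicity of a root. *)
Definition all_roots_simple : Prop :=
  forall z : K[i], let RC := map_poly (real_complex K) R in
    root RC z -> mup z RC = 1%N.

(* The integral from 0 to x, with its sign when x < 0. *)
Definition integral0 (f : K -> K) (x : K) : K :=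
  if 0 <= x then \int[@lebesgue_measure K]_(s in `[0, x]) f s
  else - \int[@lebesgue_measure K]_(s in `[x, 0]) f s.

Definition phi (G : K -> K) (x : K) : K :=
  Num.sg R^`().[0] *
  integral0 (fun s => G R.[s] / Num.sqrt calU.[s]) x.

Definition varphi (G : K -> K) (q : K) : K :=
  integral0 (fun t => G t / Num.sqrt calD.[t]) q.

End Inversion.

Definition local_inverse_at0 (K : realType) (V W : set K) (f g : K -> K) :=
  [/\ open_nbhs 0 V /\ open_nbhs 0 W,
      {homo f : x / V x >-> W x},
      {homo g : y / W y >-> V y},
      (forall x, V x -> g (f x) = x)
    & (forall y, W y -> f (g y) = y)].

(* f(x) is, for x near 0, the integral from 0 to x of r(s, sqrt (h s)), where
   the rational function r is num / den; in num and den, the outer variable is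
   the second argument of r. For s near 0 the square root is that of a
   nonnegative real and the denominator does not vanish. *)
Definition hyperelliptic_integral (K : realType) (f : K -> K) : Prop :=
  exists (h : {poly K}) (num den : {poly {poly K}}),
    let y s := Num.sqrt h.[s] in
    (\forall s \near (0 : K), 0 <= h.[s] /\ den.[(y s)%:P].[s] != 0) /\
    (\forall x \near (0 : K),
       f x = integral0 (fun s => num.[(y s)%:P].[s] / den.[(y s)%:P].[s]) x).

(* Main.v *)
(* By divisibility, U (R')^2 = D o R, so near 0 the integrand of phi is
   R'(s) G(R s) / sqrt (D (R s)): phi and varphi o R have the same derivative
   and agree at 0. Since R is locally invertible at 0, every small q is R x
   with x small, and then phi^-1 (varphi q) = phi^-1 (phi x) = x.

   For the divisibility, let c be a root of R' of multiplicity m and consider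
   the Sylvester matrix of R(y) - R(x) and R'(y) over C[x]. The substitution
   y := y + c amounts to a unimodular column operation, after which the first m
   columns are divisible by (x - c)^2, because the coefficients of y, ..., y^m
   in R(y + c) vanish and (x - c)^2 divides R(c) - R(x). Hence (x - c)^(2m)
   divides the determinant D(R(x)). *)

Require Import Defs.
From HB Require Import structures.
From mathcomp Require Import all_boot all_order all_algebra.
From mathcomp Require Import all_classical all_reals all_analysis.
From mathcomp Require Import complex.

Set Implicit Arguments.
Unset Strict Implicit.
Unset Printing Implicit Defensive.

Import Order.TTheory GRing.Theory Num.Theory.
Import numFieldNormedType.Exports.

Local Open Scope classical_set_scope.
Local Open Scope ring_scope.

(** * Divisibility of determinants and resultants *)

(** Taking [d] out of each of the first [m] columns writes [M] as a product with a diagonal matrix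
    of determinant [d ^+ m]. *)
Lemma dvdp_det_cols (L : fieldType) n m (d : {poly L}) (M : 'M[{poly L}]_n) :
  (m <= n)%N -> (forall i (j : 'I_n), (j < m)%N -> d %| M i j) ->
  d ^+ m %| \det M.
Proof.
move=> mn dM.
pose N := \matrix_(i, j < n) if (j < m)%N then M i j %/ d else M i j.
pose D := \row_(j < n) if (j < m)%N then d else 1.
have -> : M = N *m diag_mx D.
  apply/matrixP => i j; rewrite mul_mx_diag !mxE.
  by case: ifP => jm; rewrite ?mulr1// divpK ?dM.
rewrite det_mulmx det_diag; apply: dvdp_mull.
under eq_bigr do rewrite mxE.
by rewrite -big_mkcond /= -(big_ord_widen n (fun=> d) mn) prodr_const card_ord.
Qed.

(** Matrix of the substitution y := y + c in the monomial basis, acting on row vectors from the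
    right. *)
Definition shift_mx (A : comNzRingType) n (c : A) : 'M[A]_n :=
  \matrix_(i, j) (('X + c%:P) ^+ i)`_j.

(** Since (X + c)^i is monic of degree i, the matrix is lower triangular with unit diagonal. *)
Lemma det_shift_mx (A : comNzRingType) n (c : A) : \det (shift_mx n c) = 1.
Proof.
have szX (i : nat) : size (('X + c%:P) ^+ i) = i.+1.
  by rewrite -[c]opprK polyCN size_exp_XsubC.
rewrite det_trig; last first.
  by apply/is_trig_mxP => i j ij; rewrite mxE nth_default ?szX.
apply: big1 => i _; rewrite mxE.
have /monicP := monic_exp i (monicXaddC c).
by rewrite lead_coefE szX.
Qed.

Lemma poly_rV_shift (A : comNzRingType) n (c : A) (p : {poly A}) :
  (size p <= n)%N ->
  poly_rV p *m shift_mx n c = poly_rV (p \Po ('X + c%:P)).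
Proof.
move=> pn; apply/rowP => j; rewrite !mxE comp_polyE coef_sum.
rewrite (big_ord_widen n (fun i => (p`_i *: ('X + c%:P) ^+ i)`_j) pn).
rewrite [RHS]big_mkcond; apply: eq_bigr => i _; rewrite !mxE.
case: ltnP => ip; first by rewrite coefZ.
by rewrite nth_default ?mul0r.
Qed.

(** Row [k] of a Sylvester band holds the coefficients of X^k p, so multiplication by [shift_mx]
    substitutes X + c in that product. The size bound keeps [poly_rV] from truncating. *)
Lemma band_shift (A : comNzRingType) (r n : nat) (c : A) (p : {poly A})
    (k : 'I_r) (j : 'I_n) :
  (size p + k <= n)%N ->
  (lin1_mx (poly_rV \o p \o* rVpoly) *m shift_mx n c) k j =
  (('X + c%:P) ^+ k * (p \Po ('X + c%:P)))`_j.
Proof.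
move=> pn; set B := lin1_mx _; set S := shift_mx n c.
have -> : (B *m S) k j = (row k (B *m S)) 0 j by rewrite [RHS]mxE.
rewrite row_mul rowE mul_rV_lin1 /= rVpoly_delta poly_rV_shift.
  by rewrite mxE comp_polyM comp_Xn_poly.
have [->|p0] := eqVneq p 0; first by rewrite mulr0 size_poly0.
apply: leq_trans pn; rewrite addnC; apply: leq_trans (size_polyMleq _ _) _.
by rewrite size_polyXn.
Qed.

(** After the shift, column [j] holds coefficients of index [j] in multiples of P(y + c) or Q(y +
    c). These involve only the coefficients of index at most [j] of the shifted polynomials, so the
    first [m] columns are divisible by [d]. *)
Lemma dvdp_resultant (L : fieldType) (P Q : {poly {poly L}}) (c d : {poly L})
    (m : nat) :
  (m <= (size Q).-1 + (size P).-1)%N ->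
  (forall j, (j < m)%N -> d %| (P \Po ('X + c%:P))`_j) ->
  (forall j, (j < m)%N -> d %| (Q \Po ('X + c%:P))`_j) ->
  d ^+ m %| resultant P Q.
Proof.
move=> mn dP dQ.
have -> : resultant P Q = \det (Sylvester_mx P Q *m shift_mx _ c).
  by rewrite det_mulmx det_shift_mx mulr1.
have coefMd (a b : {poly {poly L}}) j : (j < m)%N ->
    (forall i, (i < m)%N -> d %| b`_i) -> d %| (a * b)`_j.
  move=> jm db; rewrite coefM; apply: (big_ind (fun x => d %| x)).
  - exact: dvdp0.
  - by move=> x y; exact: dvdp_add.
  - by move=> i _; rewrite dvdp_mull// db// (leq_ltn_trans _ jm)// leq_subr.
apply: dvdp_det_cols => // i j jm.
rewrite /Sylvester_mx mul_col_mx.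
case: (split_ordP i) => k ->; rewrite ?col_mxEu ?col_mxEd band_shift ?coefMd//.
  have k0 : (0 < (size Q).-1)%N by apply: leq_ltn_trans (ltn_ord k).
  have [->|P0] := posnP (size P); first by rewrite addn0 add0n ltnW.
  by rewrite -(prednK P0) addSn -addnS addnC leq_add2r.
have [->|P0] := posnP (size Q); first by rewrite !add0n ltnW.
by rewrite -{1}(prednK P0) addSn -addnS leq_add2l.
Qed.

Lemma dvdp_resultant_level (L : fieldType) (p : {poly L}) (c : L) (m : nat) :
  [pchar L] =i pred0 -> p^`() != 0 -> ('X - c%:P) ^+ m %| p^`() ->
  ('X - c%:P) ^+ m.*2 %|
    resultant (map_poly polyC p - p%:P) (map_poly polyC p - p%:P)^`().
Proof.
move=> ch0 p'0 cm; have [->|m0] := posnP m; first by rewrite expr0 dvd1p.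
pose t := p \Po ('X + c%:P).
have dt : t^`() = p^`() \Po ('X + c%:P).
  by rewrite deriv_comp derivD derivX derivC addr0 mulr1.
have compP (q : {poly L}) :
    map_poly polyC q \Po ('X + c%:P%:P) = map_poly polyC (q \Po ('X + c%:P)).
  by rewrite map_comp_poly rmorphD /= map_polyX map_polyC.
have t'0 j : (j < m)%N -> t^`()`_j = 0.
  move=> jm; rewrite dt; move/dvdpP: cm => [q ->].
  rewrite comp_polyM rmorphXn /= comp_polyB comp_polyX comp_polyC addrK.
  by rewrite coefMXn jm.
(* Coefficient j of t' is (j + 1) times coefficient j + 1 of t, and j + 1 is invertible in
   characteristic 0. *)
have tS j : (j.+1 < m)%N -> t`_j.+1 = 0.
  move=> jm; have := t'0 _ (ltnW jm); rewrite coef_deriv -mulr_natr => /eqP.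
  by rewrite mulf_eq0 ((pcharf0P L).1 ch0) orbF => /eqP.
(* The power is read as (d^2)^m with d = X - c, so that d^2 has to divide each of the first m
   columns. *)
rewrite -muln2 mulnC exprM; apply: (dvdp_resultant (c := c%:P)).
- apply: leq_trans (leq_addr _ _); rewrite derivB derivC subr0 deriv_map.
  rewrite size_map_polyC -ltnS prednK ?size_poly_gt0//.
  by have := dvdp_leq p'0 cm; rewrite size_exp_XsubC.
- move=> j jm; rewrite comp_polyB compP comp_polyC coefB coef_map coefC.
  case: j jm => [|j] jm; last by rewrite /= subr0 (tS j jm) dvdp0.
  (* Up to sign, the constant coefficient is p(x) - p(c), that is, t - t(0) evaluated at x - c. As
     t'(0) = 0, X^2 divides t - t(0). *)
  rewrite /= -horner_coef0 horner_comp !hornerE -dvdpNr opprB.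
  rewrite -[p](comp_polyXaddC_K _ c) -/t horner_comp !hornerE addrN.
  rewrite -comp_Xn_poly -(comp_polyC t.[0] ('X - c%:P)) -comp_polyB.
  apply: dvdp_comp_poly; rewrite -[t in t - _](poly_take_drop 2).
  suff -> : take_poly 2 t = t.[0]%:P.
    by rewrite addrAC subrr add0r dvdp_mull.
  apply/polyP => -[|[|k]]; rewrite coef_take_poly coefC ?horner_coef0//.
  by have := t'0 0%N m0; rewrite coef_deriv.
- move=> j jm; rewrite derivB derivC subr0 deriv_map compP -dt coef_map.
  by rewrite (t'0 j jm) /= dvdp0.
Qed.

(** Here [p] splits into linear factors, and powers of distinct ones are coprime, so divisibility
    can be tested one root at a time. *)
Lemma dvdp_mup_closed (F : closedFieldType) (p q : {poly F}) (k : nat) :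
  p != 0 ->
  (forall c, ('X - c%:P) ^+ (mup c p * k) %| q) -> p ^+ k %| q.
Proof.
move=> p0 pq; have [s ps] := closed_field_poly_normal p.
have lp0 : lead_coef p != 0 by rewrite lead_coef_eq0.
have mups c : mup c p = count_mem c s.
  rewrite ps -mul_polyC mupMr ?mu_prod_XsubC// rootE hornerC//.
rewrite ps exprZn dvdpZl ?expf_neq0// -prodr_undup_exp_count -prodrXl.
under eq_bigr => c _ do rewrite -exprM -mups.
have := undup_uniq s; elim: (undup s) => [|c r IH] /=.
  by rewrite big_nil dvd1p.
move=> /andP[cr /IH rq]; rewrite big_cons Gauss_dvdp ?pq ?rq//.
apply: coprimep_expl; rewrite coprimep_sym coprimep_XsubC rootE horner_prod.
rewrite prodf_seq_neq0; apply/allP => b br; rewrite horner_exp expf_neq0//.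
by rewrite hornerXsubC subr_eq0; apply: contraNneq cr => ->.
Qed.

Lemma dvdp_mup_deriv (F : fieldType) (p : {poly F}) (z : F) :
  p != 0 -> root p z -> root p^`() z -> (1 < mup z p)%N.
Proof.
move=> p0 /factor_theorem[q pE]; rewrite mup_geq// pE.
rewrite derivM derivXsubC mulr1 rootE hornerD hornerM hornerXsubC subrr mulr0.
by rewrite add0r => qz; rewrite expr2 dvdp_mul// dvdp_XsubCl.
Qed.

(** * The discriminant of R(x) - q: divisibility and sign at q = 0 *)

Section Discriminant.
Variables (K : realType) (R : {poly K}).
Hypothesis R_nonconst : (1 < size R)%N.

Let R_neq0 : R != 0. Proof. by rewrite -size_poly_gt0 ltnW. Qed.

Lemma deriv_neq0 : R^`() != 0.
Proof.
apply: contraTneq R_nonconst => R'0; rewrite -leqNgt leqNgt; apply/negP => R1.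
(* This coefficient is deg R times the leading coefficient of [R]. *)
have : R^`()`_(size R).-2 = 0 by rewrite R'0 coef0.
rewrite coef_deriv -[_.+1]/((size R).-2.+1) (_ : (size R).-2.+1 = (size R).-1).
  rewrite -lead_coefE => /eqP; rewrite mulrn_eq0 lead_coef_eq0 (negPf R_neq0).
  by case: (size R) R1 => [|[]].
by case: (size R) R1 => [|[]].
Qed.

Let S : {poly {poly K}} := map_poly polyC R - ('X : {poly K})%:P.

Lemma deriv_shifted : S^`() = map_poly polyC R^`().
Proof. by rewrite derivB derivC subr0 deriv_map. Qed.

Lemma lead_coef_shifted : lead_coef S = (lead_coef R)%:P.
Proof.
rewrite lead_coefDl ?lead_coef_map// size_polyN size_map_polyC.
by apply: leq_ltn_trans R_nonconst; rewrite size_polyC leq_b1.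
Qed.

Lemma lead_coef_deriv_shifted : lead_coef S^`() = (lead_coef R^`())%:P.
Proof. by rewrite deriv_shifted lead_coef_map. Qed.

Lemma sqr_deriv_dvdp_calD : R^`() ^+ 2 %| calD R \Po R.
Proof.
rewrite /calD comp_polyZ -mul_polyC dvdp_mull// /discr_shifted /discriminant.
rewrite !comp_polyM; apply/dvdp_mulr/dvdp_mull.
(* [f] substitutes q := R(x) and extends scalars to the complex numbers, where R' splits. It sends
   [S] to R(y) - R(x). *)
pose f : {rmorphism {poly K} -> {poly K[i]}} :=
  map_poly (real_complex K) \o comp_poly R.
pose RC := map_poly (real_complex K) R.
have fC u : f u%:P = (real_complex K u)%:P.
  by rewrite /= comp_polyC map_polyC.
(* A resultant commutes with a morphism that kills neither leading coefficient; both are nonzero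
   constants here. *)
have fres : f (resultant S S^`()) = resultant (map_poly f S) (map_poly f S^`()).
  apply: map_resultant.
    by rewrite lead_coef_shifted fC polyC_eq0 fmorph_eq0 lead_coef_eq0.
  rewrite lead_coef_deriv_shifted fC polyC_eq0 fmorph_eq0 lead_coef_eq0.
  exact: deriv_neq0.
have fS : map_poly f S = map_poly polyC RC - RC%:P.
  rewrite rmorphB /= map_polyC /= comp_polyX -!map_poly_comp; congr (_ - _).
  by apply: eq_map_poly => x /=; rewrite comp_polyC map_polyC.
rewrite -deriv_map fS in fres.
rewrite -(dvdp_map (real_complex K)) rmorphXn /= -deriv_map.
rewrite [X in _ %| X]fres.
have RC'0 : RC^`() != 0 by rewrite deriv_map map_poly_eq0 deriv_neq0.
apply: dvdp_mup_closed => // c.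
rewrite muln2; apply: dvdp_resultant_level => //; first exact: pchar_num.
by rewrite -mup_geq.
Qed.

Lemma calU_mul_sqr_deriv : calU R * R^`() ^+ 2 = calD R \Po R.
Proof. exact: divpK sqr_deriv_dvdp_calD. Qed.

Hypothesis R_simple : all_roots_simple R.

Lemma simple_rootP (z : K[i]) : let RC := map_poly (real_complex K) R in
  root RC z -> ~~ root RC^`() z.
Proof.
move=> /= Rz; apply/negP => R'z.
have := dvdp_mup_deriv _ Rz R'z.
by rewrite map_poly_eq0 R_simple// => /(_ R_neq0).
Qed.

Lemma simple_real_root (x : K) : R.[x] = 0 -> R^`().[x] != 0.
Proof.
move=> Rx; have := @simple_rootP x%:C%C.
by rewrite /= deriv_map !fmorph_root => /(_ (introT eqP Rx)).
Qed.

Lemma coprimep_deriv : coprimep R R^`().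
Proof.
rewrite -(coprimep_map (real_complex K)).
apply/Pdiv.ClosedField.coprimepP => z Rz.
by rewrite -rootE -deriv_map simple_rootP.
Qed.

(** Evaluation at q = 0 turns the resultant into that of R and R', which are coprime because the
    roots of R are simple. *)
Lemma discr_shifted0_neq0 : (discr_shifted R).[0] != 0.
Proof.
rewrite /discr_shifted /discriminant !hornerM lead_coef_shifted polyCV hornerC.
rewrite !mulf_neq0 ?invr_eq0 ?lead_coef_eq0//.
  by rewrite horner_exp expf_neq0// hornerN hornerC oppr_eq0 oner_eq0.
rewrite -/(horner_eval 0 _) map_resultant; first last.
- by rewrite lead_coef_deriv_shifted /= /horner_eval hornerC lead_coef_eq0
    deriv_neq0.
- by rewrite lead_coef_shifted /= /horner_eval hornerC lead_coef_eq0.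
rewrite -deriv_map /=.
have -> : map_poly (horner_eval 0) S = R.
  rewrite rmorphB /= map_polyC /= -map_poly_comp /horner_eval hornerX.
  rewrite polyC0 subr0.
  by rewrite map_poly_id// => x _; apply: hornerC.
by rewrite resultant_eq0 -leqNgt leq_eqVlt [X in X || _]coprimep_deriv.
Qed.

Lemma calD0_gt0 : 0 < (calD R).[0].
Proof. by rewrite /calD hornerZ -normrEsg normr_gt0 discr_shifted0_neq0. Qed.

End Discriminant.

(** * Signed integrals and local inverses near 0 *)

Section Analysis.
Variable K : realType.
Implicit Types (f g df : K -> K).

Lemma near0_norm_le (P : K -> Prop) :
  (\forall x \near (0 : K), P x) ->
  exists2 e : K, 0 < e & forall x, `|x| <= e -> P x.
Proof.
move=> /nbhs_ballP[e /= e0 eP]; exists (e / 2); first exact: divr_gt0.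
move=> x xe; apply: eP; rewrite /ball /= sub0r normrN (le_lt_trans xe)//.
by rewrite ltr_pdivrMr// ltr_pMr// ltr1n.
Qed.

Lemma near0_norm_lt (e : K) : 0 < e -> \forall x \near (0 : K), `|x| < e.
Proof.
by move=> e0; near=> x; rewrite -[x]subr0 distrC; near: x; apply: nbhsx_ballx.
Unshelve. all: by end_near. Qed.

(** The fixed lower endpoint -r removes the case split on the sign of [y], so the fundamental
    theorem of calculus applies on both sides of 0. *)
Lemma integral0_eq f (r y : K) : 0 < r -> {within `[- r, r], continuous f} ->
  `|y| < r ->
  Defs.integral0 f y = \int[@lebesgue_measure K]_(s in `[- r, y]) f s -
                  \int[@lebesgue_measure K]_(s in `[- r, 0]) f s.
Proof.
move=> r0 cf; rewrite ltr_norml => /andP[ry yr].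
have intr : (@lebesgue_measure K).-integrable `[- r, r] (EFin \o f).
  by apply: continuous_compact_integrable => //; exact: segment_compact.
have intf (a b : itv_bound K) :
    (BLeft (- r)%R <= a)%O -> (b <= BRight r)%O ->
    (@lebesgue_measure K).-integrable [set` Interval a b] (EFin \o f).
  by move=> ra br; apply: integrableS intr => //; exact: subset_itv.
have H (a b : K) : - r <= a -> a <= b -> b <= r ->
   \int[@lebesgue_measure K]_(s in `[a, b]) f s =
   \int[@lebesgue_measure K]_(s in `[- r, b]) f s -
   \int[@lebesgue_measure K]_(s in `[- r, a]) f s.
  move=> ra ab br; rewrite Rintegral_itvB ?bnd_simp//; last exact: intf.
  by rewrite Rintegral_itv_obnd_cbnd//; apply: intf; rewrite bnd_simp.
rewrite /Defs.integral0; case: leP => y0; first by rewrite H// ltW// oppr_lt0.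
by rewrite H ?opprB// ltW.
Qed.

Lemma integral00 f : Defs.integral0 f 0 = 0.
Proof. by rewrite /Defs.integral0 lexx set_itv1 Rintegral_set1. Qed.

Lemma integral0_is_derive f :
  (\forall x \near (0 : K), {for x, continuous f}) ->
  \forall x \near (0 : K), is_derive (x : K) 1 (Defs.integral0 f) (f x).
Proof.
move=> /near0_norm_le[r r0 cf].
have cfr : {within `[- r, r], continuous f}.
  apply: continuous_in_subspaceT => x; rewrite inE /= in_itv /= -ler_norml.
  exact: cf.
apply: filterS (near0_norm_lt r0) => x xr.
have /andP[rx xr'] : - r < x < r by rewrite -ltr_norml.
have intf : (@lebesgue_measure K).-integrable `[- r, r] (EFin \o f).
  by apply: continuous_compact_integrable => //; exact: segment_compact.
have [dF F'] := continuous_FTC1_closed xr' intf rx (cf _ (ltW xr)).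
pose F y := \int[@lebesgue_measure K]_(s in `[- r, y]) f s.
have : is_derive (x : K) 1 (fun y => F y - F 0) (f x).
  rewrite -[f x]subr0; apply: is_deriveB.
  by apply: DeriveDef => //; rewrite -derive1E.
apply: near_eq_is_derive; near=> y.
rewrite (@integral0_eq _ r)// ltr_norml -[_ && _]/(y \in `](- r), r[).
by near: y; apply: near_in_itvoo; rewrite in_itv /= -ltr_norml.
Unshelve. all: by end_near. Qed.

Lemma near_eq_of_is_derive f g df : f 0 = g 0 ->
  (\forall x \near (0 : K), is_derive (x : K) 1 f (df x)) ->
  (\forall x \near (0 : K), is_derive (x : K) 1 g (df x)) ->
  \forall x \near (0 : K), f x = g x.
Proof.
move=> fg0 df_f df_g.
have : \forall x \near (0 : K),
    is_derive (x : K) 1 f (df x) /\ is_derive (x : K) 1 g (df x).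
  by apply: filterS2 df_f df_g => x; split.
move=> /near0_norm_le[r r0 dfg]; apply: filterS (near0_norm_lt r0) => x xr.
pose h y := f y - g y.
have dh y : `|y| <= r -> is_derive (y : K) 1 h 0.
  by move=> /dfg[dfy dgy]; rewrite -(subrr (df y)); exact: is_deriveB.
have cst a b : - r <= a -> a <= b -> b <= r -> h a = h b.
  move=> ra ab br.
  have inr y : y \in `[a, b] -> `|y| <= r.
    rewrite in_itv /= => /andP[ay yb].
    by rewrite ler_norml (le_trans ra ay) (le_trans yb br).
  have [y yab|y yab|c _] := @MVT_segment _ h (cst 0) a b ab.
  - by apply: dh; apply: inr; apply: subset_itv_oo_cc.
  - apply: derivable_within_continuous => z zab.
    by apply: ex_derive; exact: dh (inr _ zab).
  - by rewrite mul0r => /eqP; rewrite subr_eq0 => /eqP.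
apply/eqP; rewrite -subr_eq0 -/(h x); apply/eqP.
have -> : 0 = h 0 by rewrite /h fg0 subrr.
move: xr; rewrite ltr_norml => /andP[rx xr].
case: (leP 0 x) => x0; last by apply: cst; rewrite ?ltW.
by apply/esym/cst; rewrite ?(ltW xr)// oppr_le0 ltW.
Qed.

(** A positive derivative makes [f] strictly increasing on a segment, and the intermediate value
    theorem gives surjectivity onto the image interval. The prescribed [U] allows the inverse to
    take its values where another local property holds. *)
Lemma increasing_local_inverse f df : f 0 = 0 ->
  (\forall x \near (0 : K), is_derive (x : K) 1 f (df x) /\ 0 < df x) ->
  forall U, nbhs 0 U -> exists V W psi,
    [/\ local_inverse_at0 V W f psi, V `<=` U
      & psi y @[y --> (0 : K)] --> (0 : K)].
Proof.
move=> f0 dff U /near0_norm_le[u u0 uU].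
have [r0 r00 dr0] := near0_norm_le dff.
pose r := Num.min u r0.
have rgt0 : 0 < r by rewrite lt_min u0.
have dr y : `|y| <= r -> is_derive (y : K) 1 f (df y) /\ 0 < df y.
  by rewrite le_min => /andP[_ /dr0].
have cf : {within `[- r, r], continuous f}.
  apply: derivable_within_continuous => z; rewrite in_itv /= -ler_norml.
  by move=> /dr[? _]; exact: ex_derive.
have rr : - r < r by rewrite gtrN.
have mono : {in `[- r, r] &, {homo f : x y / x < y}}.
  apply: gtr0_derive1_lt_cc => // z;
    rewrite in_itv /= -ltr_norml => /ltW/dr[dz d0].
    exact: ex_derive.
  by rewrite derive1E derive_val.
have lemono : {in `[- r, r] &, {mono f : x y / x <= y}} by exact: le_mono_in.
have ltmono : {in `[- r, r] &, {mono f : x y / x < y}} by exact: leW_mono_in.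
have inj : {in `[- r, r] &, injective f}.
  move=> x y xr yr fxy; apply/eqP.
  by rewrite eq_le -(lemono x y)// -(lemono y x)// fxy lexx.
have Nrr : - r \in `[- r, r] by rewrite in_itv /= lexx ltW.
have rr' : r \in `[- r, r] by rewrite in_itv /= lexx ltW.
have oo_cc x : x \in `](- r), r[ -> x \in `[- r, r] by exact: subset_itv_oo_cc.
have fV x : x \in `](- r), r[ -> f x \in `]f (- r), f r[.
  move=> xr; have /andP[x1 x2] : - r < x < r by rewrite in_itv in xr.
  by rewrite in_itv /=; apply/andP; split; apply: mono => //; exact: oo_cc.
have fW y : y \in `]f (- r), f r[ -> exists2 x, x \in `](- r), r[ & f x = y.
  move=> yW; have /andP[y1 y2] : f (- r) < y < f r by rewrite in_itv in yW.
  have [|z zr fz] := @IVT _ f (- r) r y (ltW rr) cf.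
    by rewrite ge_min le_max (ltW y1) (ltW y2) orbT.
  exists z => //.
  by rewrite in_itv /= -(ltmono (- r) z)// -(ltmono z r)// fz y1.
pose V := `](- r), r[%classic; pose W := `]f (- r), f r[%classic.
(* The default 0 is taken only outside [W]. *)
pose psi y := xget 0 [set x | V x /\ f x = y].
have psiP y : W y -> V (psi y) /\ f (psi y) = y.
  by move=> /fW[z zV fz]; rewrite /psi; case: xgetP => [t -> //|/(_ z)[]].
have V0 : V 0 by rewrite /V /= in_itv /= oppr_lt0 rgt0.
exists V, W, psi; split.
- split=> //.
  + by split; (split; first exact: itv_open) => //; rewrite -f0; exact: fV.
  + by move=> y /psiP[].
  + move=> x Vx; have [Vp fp] := psiP _ (fV _ Vx).
    by apply: inj => //; exact: oo_cc.
  + by move=> y /psiP[].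
- move=> x Vx; apply: uU; move: Vx; rewrite /V /= in_itv /= -ltr_norml => /ltW.
  by rewrite le_min => /andP[].
- apply/cvgr0Pnorm_lt => e e0.
  (* With d at most r, f is monotone on [-d, d], and f(-d) < y < f(d) forces |psi y| < d. *)
  pose d := Num.min e r; have d0 : 0 < d by rewrite lt_min e0.
  have dr' : d <= r by rewrite ge_min lexx orbT.
  have Ndr : - d \in `[- r, r].
    by rewrite in_itv /= lerN2 dr' (le_trans _ (ltW rgt0))// oppr_le0 ltW.
  have dr2 : d \in `[- r, r].
    by rewrite in_itv /= dr' (le_trans _ (ltW d0))// oppr_le0 ltW.
  near=> y.
  have yd : y \in `]f (- d), f d[.
    near: y; apply: near_in_itvoo.
    rewrite in_itv /= -f0 !ltmono ?(oo_cc 0 V0)//.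
    by rewrite oppr_lt0 d0.
  have [|Vp fp] := psiP y.
    rewrite /W /=; apply: subset_itv yd; rewrite bnd_simp lemono//.
    by rewrite lerN2.
  have : `|psi y| < d.
    have pr : psi y \in `[- r, r] := oo_cc _ Vp.
    have /andP[y1 y2] : f (- d) < y < f d by rewrite in_itv in yd.
    by rewrite ltr_norml -(ltmono (- d) _ Ndr pr) -(ltmono _ d pr dr2) fp y1.
  by rewrite lt_min => /andP[].
Unshelve. all: by end_near. Qed.

(** By continuity [df] keeps its sign near 0. If it is negative, the increasing case applies to -f,
    and its inverse is composed with negation. *)
Lemma local_inverse f df : f 0 = 0 -> {for 0, continuous df} -> df 0 != 0 ->
  (\forall x \near (0 : K), is_derive (x : K) 1 f (df x)) ->
  forall U, nbhs 0 U -> exists V W psi,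
    [/\ local_inverse_at0 V W f psi, V `<=` U
      & psi y @[y --> (0 : K)] --> (0 : K)].
Proof.
move=> f0 cdf df0 dff U nU.
have [df_gt0|df_lt0] : 0 < df 0 \/ df 0 < 0 by apply/orP; rewrite orbC -neq_lt.
  apply: (increasing_local_inverse (df := df) f0 _ nU).
  by apply: filterS2 dff (cvgr_gt _ cdf _ df_gt0) => x; split.
have dffN : \forall x \near (0 : K),
    is_derive (x : K) 1 (fun y => - f y) (- df x) /\ 0 < - df x.
  apply: filterS2 dff (cvgr_lt _ cdf _ df_lt0) => x dfx dx.
  by rewrite oppr_gt0; split=> //; exact: is_deriveN.
have [|V [W [psi [[[nV [oW W0]] VW WV psif fpsi] VU psi0]]]] :=
  @increasing_local_inverse (fun y => - f y) (fun x => - df x) _ dffN U nU.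
  by rewrite f0 oppr0.
exists V, (-%R @^-1` W), (psi \o -%R); split=> //.
- split; [|exact: VW|by move=> y; exact: WV|exact: psif|].
  + split=> //; split; last by rewrite /= oppr0.
    by apply: open_comp oW => x _; exact: opp_continuous.
  + by move=> y /fpsi /(congr1 -%R); rewrite /= !opprK.
- have oppc : (- y : K) @[y --> (0 : K)] --> (0 : K).
    by rewrite -[X in _ --> X]oppr0; exact: cvgN.
  exact: cvg_comp oppc psi0.
Qed.

End Analysis.

(** * Integrands with the square root of a polynomial positive at 0 *)

Section InverseSqrt.
Variables (K : realType) (g : K -> K) (p : {poly K}).
Hypotheses (cg : continuous g) (p0 : 0 < p.[0]).

Lemma near0_horner_gt0 : \forall x \near (0 : K), 0 < p.[x].
Proof. exact: (cvgr_gt _ (@continuous_horner K p 0) _ p0). Qed.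

Lemma continuous_div_sqrt x : 0 < p.[x] ->
  {for x, continuous (fun s => g s / Num.sqrt p.[s])}.
Proof.
move=> px; apply: continuousM; first exact: cg.
apply: continuousV; first by rewrite gt_eqF// sqrtr_gt0.
apply: continuous_comp; first exact: continuous_horner.
exact: sqrt_continuous.
Qed.

Lemma integral0_div_sqrt_is_derive : \forall x \near (0 : K),
  is_derive (x : K) 1 (Defs.integral0 (fun s => g s / Num.sqrt p.[s]))
    (g x / Num.sqrt p.[x]).
Proof.
apply: integral0_is_derive.
by apply: filterS near0_horner_gt0 => x; exact: continuous_div_sqrt.
Qed.

End InverseSqrt.

(** * The functions [phi] and [varphi] *)

Section MainProof.
Variables (K : realType) (R : {poly K}) (G : K -> K).
Hypotheses (R_nonconst : (1 < size R)%N) (R0 : R.[0] = 0).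
Hypotheses (R_simple : all_roots_simple R) (cG : continuous G).

Let R'0 : R^`().[0] != 0. Proof. exact: simple_real_root. Qed.

Lemma calU_horner x : (calU R).[x] * R^`().[x] ^+ 2 = (calD R).[R.[x]].
Proof.
by rewrite -horner_comp -(calU_mul_sqr_deriv R_nonconst) hornerM horner_exp.
Qed.

Lemma calU0_gt0 : 0 < (calU R).[0].
Proof.
have R'2 : 0 < R^`().[0] ^+ 2 by rewrite exprn_even_gt0.
by rewrite -(pmulr_lgt0 _ R'2) calU_horner R0 calD0_gt0.
Qed.

Lemma continuous_comp_horner : continuous (fun s => G R.[s]).
Proof.
by move=> x; apply: continuous_comp (@continuous_horner K R x) (@cG _).
Qed.

Lemma phi_is_derive : \forall x \near (0 : K),
  is_derive (x : K) 1 (phi R G)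
    (Num.sg R^`().[0] * (G R.[x] / Num.sqrt (calU R).[x])).
Proof.
apply: filterS (integral0_div_sqrt_is_derive continuous_comp_horner calU0_gt0).
by move=> x dx; exact: is_deriveZ.
Qed.

Lemma varphi_is_derive : \forall q \near (0 : K),
  is_derive (q : K) 1 (varphi R G) (G q / Num.sqrt (calD R).[q]).
Proof.
exact: (integral0_div_sqrt_is_derive cG (calD0_gt0 R_nonconst R_simple)).
Qed.

Lemma phi0 : phi R G 0 = 0.
Proof. by rewrite /phi integral00 mulr0. Qed.

(** This lets the constant sgn(R'(0)) in [phi] be replaced by sgn(R'(x)) near 0. *)
Lemma near0_sgr_deriv :
  \forall x \near (0 : K), Num.sg R^`().[x] = Num.sg R^`().[0].
Proof.
have cR' := @continuous_horner K R^`() 0.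
have [R'_gt0|R'_lt0] : 0 < R^`().[0] \/ R^`().[0] < 0.
  by apply/orP; rewrite orbC -neq_lt.
  by apply: filterS (cvgr_gt _ cR' _ R'_gt0) => x R'x; rewrite !gtr0_sg.
by apply: filterS (cvgr_lt _ cR' _ R'_lt0) => x R'x; rewrite !ltr0_sg.
Qed.

Lemma phi_varphi : \forall x \near (0 : K), phi R G x = varphi R G R.[x].
Proof.
apply: near_eq_of_is_derive phi_is_derive _.
  by rewrite phi0 R0 /varphi integral00.
have cR : R.[x] @[x --> (0 : K)] --> (0 : K).
  by rewrite -[X in _ --> X]R0; exact: continuous_horner.
have dvarphi := cR _ varphi_is_derive.
near=> x.
have U_gt0 : 0 < (calU R).[x] by near: x; exact: near0_horner_gt0 calU0_gt0.
have sgR' : Num.sg R^`().[x] = Num.sg R^`().[0].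
  by near: x; exact: near0_sgr_deriv.
have R'x : R^`().[x] != 0 by rewrite -sgr_eq0 sgR' sgr_eq0.
have dRx : is_derive R.[x] 1 (varphi R G) (G R.[x] / Num.sqrt (calD R).[R.[x]]).
  by near: x.
(* The root of D(R(x)) is the root of U(x) times |R'(x)|, and R'(x) / |R'(x)| is the sign of
   R'(x). *)
have -> : Num.sg R^`().[0] * (G R.[x] / Num.sqrt (calU R).[x]) =
    G R.[x] / Num.sqrt (calD R).[R.[x]] * R^`().[x].
  rewrite -sgR' -calU_horner sqrtrM ?ltW// sqrtr_sqr invfM.
  rewrite -!mulrA mulrCA; congr (_ * _); rewrite mulrC; congr (_ * _).
  by rewrite {3}[R^`().[x]]numEsg mulrCA mulVf ?normr_eq0// mulr1.
exact: is_derive1_comp.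
Unshelve. all: by end_near. Qed.

Lemma hyperelliptic_phi : (exists g : {poly K}, forall t, G t = g.[t]) ->
  hyperelliptic_integral (phi R G).
Proof.
move=> [g Gg]; set c := Num.sg R^`().[0].
(* The rational function is r(s, y) = c g(R(s)) / y: the numerator is constant in the outer variable
   y, and ['X] is y. *)
exists (calU R), (c *: (g \Po R))%:P, 'X; split.
  apply: filterS (near0_horner_gt0 calU0_gt0) => x Ux.
  by rewrite ltW// hornerX hornerC gt_eqF// sqrtr_gt0.
rewrite (_ : (fun s => _) = (fun s => c * G R.[s] / Num.sqrt (calU R).[s])).
  (* Comparing derivatives moves the constant [c] inside the integral. *)
  apply: near_eq_of_is_derive phi_is_derive _.
    by rewrite phi0 integral00.
  have cc : continuous (fun s => c * G R.[s]).
    by move=> x; apply: cvgM; [exact: cvg_cst|exact: continuous_comp_horner].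
  apply: filterS (integral0_div_sqrt_is_derive cc calU0_gt0) => x.
  by rewrite mulrA.
by apply/funext => s; rewrite !hornerX !hornerC hornerZ horner_comp Gg.
Qed.

Lemma hyperelliptic_varphi : (exists g : {poly K}, forall t, G t = g.[t]) ->
  hyperelliptic_integral (varphi R G).
Proof.
move=> [g Gg]; have D0 := calD0_gt0 R_nonconst R_simple.
exists (calD R), g%:P, 'X; split.
  apply: filterS (near0_horner_gt0 D0) => x Dx.
  by rewrite ltW// hornerX hornerC gt_eqF// sqrtr_gt0.
apply: (@filterE _ (nbhs (0 : K))) => x; congr Defs.integral0.
by apply/funext => s; rewrite !hornerX !hornerC Gg.
Qed.

End MainProof.

Theorem theorem1p2 (K : realType) (n : nat) (R : {poly K}) (G : K -> K)
    (hn : (2 <= n)%N) (hdeg : size R = n.+1) (hR0 : R.[0] = 0)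
    (hsimple : all_roots_simple R)
    (hG : continuous G) (hG0 : G 0 != 0) :
  (exists (V W : set K) (psi : K -> K),
    [/\ local_inverse_at0 V W (phi R G) psi,
        (\forall q \near (0 : K),
           W (varphi R G q) /\ root (shifted R q) (psi (varphi R G q)))
      & psi (varphi R G q) @[q --> (0 : K)] --> (0 : K)]) /\
  ((exists g : {poly K}, forall t, G t = g.[t]) ->
     hyperelliptic_integral (phi R G) /\ hyperelliptic_integral (varphi R G)).
Proof.
have R1 : (1 < size R)%N by rewrite hdeg ltnS ltnW.
split; last first.
  by move=> gG; split; [exact: hyperelliptic_phi|exact: hyperelliptic_varphi].
have U0 := calU0_gt0 R1 hR0 hsimple.
have R'0 : R^`().[0] != 0 by exact: simple_real_root.
have [||V [W [psi [[[[oV V0] oW] VW WV psiK phiK] _ _]]]] :=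
    local_inverse (phi0 R G) _ _ (phi_is_derive R1 hR0 hsimple hG) filterT.
- apply: continuousM; first exact: cvg_cst.
  exact: (continuous_div_sqrt (continuous_comp_horner hG) U0).
- rewrite hR0 !mulf_neq0 ?sgr_eq0 ?invr_eq0//.
  by rewrite gt_eqF// sqrtr_gt0.
(* The local inverse [rho] of R is to take its values in this neighborhood, where [psi] inverts
   [phi] and [phi] agrees with [varphi] composed with R. *)
have nV : \forall x \near (0 : K), V x /\ phi R G x = varphi R G R.[x].
  have nV := open_nbhs_nbhs (conj oV V0).
  by apply: filterS2 nV (phi_varphi R1 hR0 hsimple hG).
have dR : \forall x \near (0 : K), is_derive (x : K) 1 (horner R) R^`().[x].
  by apply: (@filterE _ (nbhs (0 : K))) => x; exact: is_derive_poly.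
have [VR [WR [rho [[[_ oWR] _ WVR _ rhoK] VRV rho0]]]] :=
  local_inverse hR0 (@continuous_horner K R^`() 0) R'0 dR nV.
exists V, W, psi; split=> //.
- apply: filterS (open_nbhs_nbhs oWR) => q /[dup] /WVR /VRV[Vq phiq] WRq.
  (* Writing q = R(rho q) gives varphi(q) = phi(rho q), hence psi(varphi(q)) = rho q, a root of R -
     q. *)
  rewrite -[q in varphi R G q](rhoK _ WRq) -phiq psiK//; split; first exact: VW.
  by rewrite rootE /shifted !hornerE rhoK ?subrr.
(* Near 0 the root coincides with rho q, which tends to 0. *)
- apply: cvg_trans rho0; apply: near_eq_cvg.
  apply: filterS (open_nbhs_nbhs oWR) => q /[dup] /WVR /VRV[Vq phiq] WRq.
  by rewrite -[q in varphi R G q](rhoK _ WRq) -phiq psiK.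
Qed.
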